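(* Let $G$ be a finite group, and let $X\in M_{|G|}(\mathcal A)$ be self-adjoint, free from $M_{|G|}(\mathbb C)$ with respect to $\varphi$, and with distribution $\mu$. Let $X^t=\sum_{g\in G}Y_g$ be the left $G$-circulant decomposition of $X^t$, and let $R\subseteq G$ be a complete set of representatives of the inverse pairs $\{g,g^{-1}\}$ with $g\neq g^{-1}$. Then for every $g\in R$ the distribution of $Y_g+Y_{g^{-1}}$ is $$\mu_{Y_g+Y_{g^{-1}}}=\big(D_{\frac1{|G|}}\mu\big)^{\boxplus |G|}\boxplus\big(D_{-\frac1{|G|}}\mu\big)^{\boxplus |G|}.$$
   Context: $(\mathcal A,\tau)$ is a $*$-probability space (unital complex $*$-algebra with a linear functional $\tau$, $\tau(1)=1$) with $\tau$ tracial. $M_{|G|}(\mathcal A)$ carries $\varphi(A)=\frac1{|G|}\sum_{h\in G}\tau(A_{h,h})$ and contains $M_{|G|}(\mathbb C)$ via $\mathbb C\cdot1\subset\mathcal A$; rows and columns are indexed by $G$ through a fixed enumeration. ''$X$ is free from $M_{|G|}(\mathbb C)$'' means that the unital algebra generated by $X$ and $M_{|G|}(\mathbb C)$ are freely independent with respect to $\varphi$. Transpose: $(X^t)_{p,q}=X_{q,p}$. Left $G$-circulant decomposition of $A\in M_{|G|}(\mathcal A)$: $A=\sum_{g\in G}A_g$ with $(A_g)_{p,q}=A_{p,q}$ if $q=gp$ and $0$ otherwise. The distribution of an element $a$ is determined by its moments $\varphi(a^n)$, $n\ge1$ (equivalently by its free cumulants $\kappa_n(a):=\kappa_n(a,\dots,a)$);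 it is identified with a probability measure having these moments when appropriate. $D_c\mu$ denotes the dilation of $\mu$ by $c$ (the distribution of $ca$ if $a$ has distribution $\mu$), with $\kappa_n(D_c\mu)=c^n\kappa_n(\mu)$; $\boxplus$ is free additive convolution, $\kappa_n(\mu\boxplus\nu)=\kappa_n(\mu)+\kappa_n(\nu)$; and $\mu^{\boxplus t}$ is the free convolution power, $\kappa_n(\mu^{\boxplus t})=t\,\kappa_n(\mu)$. *)

(* Defs.v *)
From HB Require Import structures.
From mathcomp Require Import all_boot all_order all_algebra all_fingroup.
From mathcomp Require Import reals complex.

Set Implicit Arguments.
Unset Strict Implicit.
Unset Printing Implicit Defensive.

Import GRing.Theory.
Local Open Scope ring_scope.
Local Open Scope complex_scope.

Section FreeCumulants.
Variable F : comNzRingType.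

Definition nc_partition n (P : {set {set 'I_n}}) : bool :=
  partition P [set: 'I_n] &&
  [forall B in P, forall B' in P,
    [forall a in B, forall b in B', forall c in B, forall d in B',
      [&& a < b, b < c & c < d]%N ==> (B == B')]].

(* The moment-cumulant formula
   m_n = \sum_(P in NC(n)) \prod_(B in P) kappa_|B|. *)
Definition cumulants_to_moments (kappa : nat -> F) (n : nat) : F :=
  \sum_(P : {set {set 'I_n}} | nc_partition P) \prod_(B in P) kappa #|B|.

(* The first n free cumulants of the moment sequence m, obtained by solving
   the moment-cumulant formula for the term of the one-block partition. *)
Fixpoint free_cumulant_seq (m : nat -> F) (n : nat) : seq F :=
  if n is k.+1 then
    let s := free_cumulant_seq m k in
    rcons s (m k - \sum_(P : {set {set 'I_k}} |
                      nc_partition P && (P != [set [set: 'I_k]]))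
                     \prod_(B in P) s`_#|B|)
  else [::].

(* Only n >= 1 is meaningful. *)
Definition free_cumulant (m : nat -> F) (n : nat) : F :=
  (free_cumulant_seq m n.+1)`_n.

Lemma size_free_cumulant_seq m n : size (free_cumulant_seq m n) = n.
Proof. by elim: n => //= n IHn; rewrite size_rcons IHn. Qed.

Lemma nth_free_cumulant_seq m n k :
  (k < n)%N -> (free_cumulant_seq m n)`_k = free_cumulant m k.
Proof.
elim: n => // n IHn; rewrite ltnS leq_eqVlt => /predU1P[-> //|lt_kn] /=.
by rewrite nth_rcons size_free_cumulant_seq lt_kn IHn.
Qed.

Lemma nc_partition_block_lt n (P : {set {set 'I_n}}) B :
  nc_partition P -> P != [set [set: 'I_n]] -> B \in P -> (#|B| < n)%N.
Proof.
case/andP=> partP _ nP1 PB; rewrite -[n in (_ < n)%N]card_ord -cardsT.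
apply: proper_card; rewrite properE subsetT /=.
apply: contra nP1 => sTB; apply/eqP/setP => B'; rewrite inE.
have defB : B = [set: 'I_n] by apply/eqP; rewrite eqEsubset subsetT.
apply/idP/eqP => [PB'|->]; last by rewrite -defB.
case/and3P: partP => _ /trivIsetP tiP P0; rewrite -defB.
apply/eqP; apply: contraT => neB'B; case/negP: P0.
have := tiP _ _ PB' PB neB'B; rewrite defB -setI_eq0 setIT => /eqP <-.
exact: PB'.
Qed.

Lemma free_cumulantE m n : free_cumulant m n =
  m n - \sum_(P : {set {set 'I_n}} |
               nc_partition P && (P != [set [set: 'I_n]]))
          \prod_(B in P) free_cumulant m #|B|.
Proof.
rewrite {1}/free_cumulant /= nth_rcons size_free_cumulant_seq ltnn eqxx.
congr (_ - _); apply: eq_bigr => P /andP[ncP nP1]; apply: eq_bigr => B PB.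
by apply: nth_free_cumulant_seq; apply: nc_partition_block_lt PB.
Qed.

Lemma nc_partition_setT n : nc_partition [set [set: 'I_n.+1]].
Proof.
apply/andP; split.
  apply/and3P; split; first by rewrite /cover big_set1.
    by apply/trivIsetP => A B /set1P-> /set1P->; rewrite eqxx.
  by rewrite inE eq_sym -card_gt0 cardsT card_ord.
apply/forall_inP => B /set1P->; apply/forall_inP => B' /set1P->.
by do 4! [apply/forall_inP => ? _]; rewrite eqxx implybT.
Qed.

Lemma cumulants_to_momentsS kappa n : cumulants_to_moments kappa n.+1 =
  kappa n.+1 + \sum_(P : {set {set 'I_n.+1}} |
                      nc_partition P && (P != [set [set: 'I_n.+1]]))
                 \prod_(B in P) kappa #|B|.
Proof.
rewrite /cumulants_to_moments (bigD1 _ (nc_partition_setT n)) /=.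
by rewrite big_set1 cardsT card_ord.
Qed.

Lemma free_cumulantK m n :
  cumulants_to_moments (free_cumulant m) n.+1 = m n.+1.
Proof. by rewrite cumulants_to_momentsS free_cumulantE subrK. Qed.

Lemma cumulants_to_momentsK kappa n :
  free_cumulant (cumulants_to_moments kappa) n.+1 = kappa n.+1.
Proof.
elim/ltn_ind: n => n IHn.
rewrite free_cumulantE cumulants_to_momentsS.
set S := \sum_(P | _) _; set S' := \sum_(P | _) _.
suff -> : S' = S by rewrite addrK.
apply: eq_bigr => P /andP[ncP nP1]; apply: eq_bigr => B PB.
have := nc_partition_block_lt ncP nP1 PB.
case cardB : #|B| => [|k]; last by rewrite ltnS; apply: IHn.
case/andP: ncP => /and3P[_ _ P0] _; case/negP: P0.
by rewrite -(cards0_eq cardB).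
Qed.

(* Distributions are represented by their moment sequences. *)
Definition dilation (c : F) (mu : nat -> F) : nat -> F :=
  fun n => c ^+ n * mu n.

Definition free_convolution (mu nu : nat -> F) : nat -> F :=
  cumulants_to_moments (fun n => free_cumulant mu n + free_cumulant nu n).

Definition free_power (mu : nat -> F) (t : F) : nat -> F :=
  cumulants_to_moments (fun n => t * free_cumulant mu n).

End FreeCumulants.

Section Noncommutative.
Variable C : fieldType.

Definition distribution (B : pzRingType) (phi : B -> C) (a : B) : nat -> C :=
  fun n => phi (a ^+ n).

(* For unital subalgebras S i of B: alternating products of centered
   elements are centered. *)
Definition freely_independent (I : Type) (B : pzRingType) (phi : B -> C)
    (S : I -> B -> Prop) : Prop :=
  forall (n : nat) (i : nat -> I) (a : nat -> B),
    (0 < n)%N ->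
    (forall k, (k.+1 < n)%N -> i k <> i k.+1) ->
    (forall k, (k < n)%N -> S (i k) (a k)) ->
    (forall k, (k < n)%N -> phi (a k) = 0) ->
    phi (\prod_(k < n) a k) = 0.

Variables (A : algType C) (n : nat).

Definition mx_functional (tau : A -> C) (M : 'M[A]_n) : C :=
  n%:R^-1 * \sum_(h < n) tau (M h h).

Definition scalar_entries (M : 'M[A]_n) : Prop :=
  exists B : 'M[C]_n, M = map_mx (in_alg A) B.

(* The unital C-algebra generated by M; c%:A%:M is c times the identity. *)
Inductive generated_algebra (M : 'M[A]_n) : 'M[A]_n -> Prop :=
| Generated_gen : generated_algebra M M
| Generated_scalar (c : C) : generated_algebra M c%:A%:M
| Generated_add N P : generated_algebra M N -> generated_algebra M P ->
    generated_algebra M (N + P)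
| Generated_mul N P : generated_algebra M N -> generated_algebra M P ->
    generated_algebra M (N * P).

Definition free_from_scalar_mx (tau : A -> C) (M : 'M[A]_n) : Prop :=
  freely_independent (mx_functional tau)
    (fun b : bool => if b then generated_algebra M else scalar_entries).

(* Row and column indices stand for group elements through e. *)
Definition left_circulant (gT : finGroupType) (e : 'I_n -> gT)
    (M : 'M[A]_n) (g : gT) : 'M[A]_n :=
  \matrix_(p, q) if e q == (g * e p)%g then M p q else 0.

End Noncommutative.

Lemma left_circulant_sum (C : fieldType) (A : algType C) n
    (gT : finGroupType) (e : 'I_n -> gT) (M : 'M[A]_n) :
  M = \sum_(g : gT) left_circulant e M g.
Proof.
apply/matrixP => p q; rewrite summxE.
rewrite (bigD1 (e q * (e p)^-1)%g) //= mxE mulgKV eqxx big1 ?addr0 // => g neq_g.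
by rewrite mxE; case: eqP => // eq_q; rewrite eq_q mulgK eqxx in neq_g.
Qed.

Definition star_operation (R : rcfType) (A : algType R[i])
    (star : A -> A) : Prop :=
  [/\ forall a b, star (a + b) = star a + star b,
      forall (c : R[i]) a, star (c *: a) = c^* *: star a,
      forall a b, star (a * b) = star b * star a
    & forall a, star (star a) = a].

Definition unital_trace (C : fieldType) (A : algType C)
    (tau : {scalar A}) : Prop :=
  tau 1 = 1 /\ forall a b : A, tau (a * b) = tau (b * a).

Definition selfadjoint_mx (A : Type) (star : A -> A) n (M : 'M[A]_n) : Prop :=
  (map_mx star M)^T = M.

Definition inverse_pair_reps (gT : finGroupType) (Rep : {set gT}) : bool :=
  is_transversal Rep
    [set [set g; g^-1%g] | g in [set g : gT | g != g^-1%g]]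
    [set g : gT | g != g^-1%g].

(* Main.v *)
Require Import Defs.
From HB Require Import structures.
From mathcomp Require Import all_boot all_order all_algebra all_fingroup.
From mathcomp Require Import reals complex zify ring.

Set Implicit Arguments.
Unset Strict Implicit.
Unset Printing Implicit Defensive.

Import GRing.Theory.
Local Open Scope ring_scope.

(** Write N for the order of G and E_(p,q) for the matrix units. Since
    Y_g = \sum_p E_(p,gp) X E_(p,gp), the moments of Z = Y_g + Y_(g^-1) are mixed
    moments of X and scalar matrices, which freeness determines.

    The tool is the Schwinger-Dyson equation. If X has free cumulants kappa_r
    and is free from an algebra B, then for every word Q in X and B
      phi(X Q) = \sum_r kappa_r \sum phi(Q_1) phi(Q_2) ... phi(Q_r),
    where the inner sum runs over the ways of marking r - 1 of the letters X of
    Q, and Q_1, ..., Q_r are the words between the marks: the leading X and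
    the marked ones form a block of a noncrossing partition. Both sides are
    linear in Q, hence only alternating products Q of centered elements matter.
    If such a Q involves B, both sides vanish by freeness; if Q is a polynomial
    in X, the equation is the recursion on the block of the first point that
    relates moments and cumulants (cumulants_to_moments_first_block). So the
    equation (schwinger_dyson) only needs this recursion and no Kreweras
    complements.

    The equation is then applied to X E_(u,v) Z^m, where the factors are
      phi(E_(u,v) Z^k E_(p,q)) = N^-1 [u = q] tau((Z^k)_(v,p)).
    By induction tau((Z^k)_(v,p)) = [v = p] M_k for a number M_k. Hence the
    next marked letter of a block must retrace the step p -> gp or p -> g^-1 p of
    the previous one: it comes from Y_(h^-1) if the previous one comes from Y_h,
    and there is exactly one such choice because g != g^-1. A block closes
    only if its steps lead back to the starting point, thus after an even number
    of letters since g != 1. Counting the two choices of the first step, M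
    satisfies the first-block recursion with cumulants 2 N^(1-r) kappa_r for even r
    and 0 for odd r, that is N (1/N)^r kappa_r + N (-1/N)^r kappa_r, which are the
    free cumulants of the claimed free convolution. *)

(** * Sums over noncrossing partitions *)

Section NCSums.
Variables (F : comNzRingType) (m : nat).
Implicit Types (P Q : {set {set 'I_m}}) (S B : {set 'I_m}).

Definition noncrossing P : bool :=
  [forall B in P, forall B' in P,
    [forall a in B, forall b in B', forall c in B, forall d in B',
      [&& a < b, b < c & c < d]%N ==> (B == B')]].

(** The ambient type stays 'I_m while S shrinks to intervals and their
    complements, so that no recursion ever relabels points. *)
Definition nc_on S P : bool := partition P S && noncrossing P.

Definition nc_sum (f : {set 'I_m} -> F) S : F :=
  \sum_(P | nc_on S P) \prod_(B in P) f B.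

Lemma noncrossingP P : reflect
  (forall B B' a b c d, B \in P -> B' \in P ->
     a \in B -> b \in B' -> c \in B -> d \in B' ->
     (a < b)%N -> (b < c)%N -> (c < d)%N -> B = B')
  (noncrossing P).
Proof.
apply: (iffP idP) => [ncP B B' a b c d PB PB' Ba B'b Bc B'd ab bc cd|ncP].
  move/forall_inP: ncP => /(_ B PB)/forall_inP/(_ B' PB').
  move=> /forall_inP/(_ a Ba)/forall_inP/(_ b B'b).
  move=> /forall_inP/(_ c Bc)/forall_inP/(_ d B'd).
  by rewrite ab bc cd => /eqP.
apply/forall_inP => B PB; apply/forall_inP => B' PB'.
apply/forall_inP => a Ba; apply/forall_inP => b B'b.
apply/forall_inP => c Bc; apply/forall_inP => d B'd.
by apply/implyP => /and3P[ab bc cd]; apply/eqP; apply: (ncP _ _ a b c d).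
Qed.

Lemma partition_blocksP P S : reflect
  [/\ forall B, B \in P -> B != set0,
      forall B x, B \in P -> x \in B -> x \in S,
      forall x, x \in S -> exists2 B, B \in P & x \in B
    & forall B B' x, B \in P -> B' \in P -> x \in B -> x \in B' -> B = B']
  (partition P S).
Proof.
apply: (iffP and3P) => [[/eqP covP /trivIsetP tiP P0]|[P0 PS SP tiP]].
  split=> [B PB|B x PB Bx|x Sx|B B' x PB PB' Bx B'x].
  - by apply: contraNneq P0 => <-.
  - by rewrite -covP; apply/bigcupP; exists B.
  - by move: Sx; rewrite -covP => /bigcupP[B PB Bx]; exists B.
  apply/eqP; apply: contraT => /(tiP _ _ PB PB').
  by rewrite disjoint_subset => /subsetP/(_ x Bx); rewrite inE B'x.
split.
- apply/eqP/setP => x; apply/bigcupP/idP => [[B PB Bx]|/SP[B PB Bx]].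
    exact: PS Bx.
  by exists B.
- apply/trivIsetP => B B' PB PB'; apply: contraR => /pred0Pn[x /andP[/= Bx B'x]].
  by apply/eqP; apply: tiP Bx B'x.
by apply/negP => /P0; rewrite eqxx.
Qed.

(** When no point of S2 lies between two points of S1, a union of noncrossing
    partitions of S1 and of S2 is noncrossing: for two crossing blocks, one from
    each side, a point of the S2 block would separate two points of the S1
    block. The predicate Q carries the constraint on the block that is being
    built inside S2. *)
Lemma nc_sum_glue (f : {set 'I_m} -> F) S1 S2 (Q : pred {set {set 'I_m}}) :
  (forall x, x \in S1 -> x \in S2 -> False) ->
  (forall x y z, x \in S1 -> y \in S2 -> z \in S1 -> (x < y < z)%N -> False) ->
  \sum_(P | [&& nc_on (S1 :|: S2) P,
                [forall B in P, (B \subset S1) || (B \subset S2)]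
              & Q (P ::&: S2)]) \prod_(B in P) f B
  = nc_sum f S1 * \sum_(P | nc_on S2 P && Q P) \prod_(B in P) f B.
Proof.
move=> dis12 conv.
pose glue (PP : {set {set 'I_m}} * {set {set 'I_m}}) := PP.1 :|: PP.2.
pose cut P := (P ::&: S1, P ::&: S2).
rewrite (reindex_onto glue cut) /=; last first.
  move=> P /and3P[_ /forall_inP splitP _]; apply/setP => B.
  rewrite !inE -andb_orr; apply: andb_idr; exact: splitP.
rewrite /nc_sum big_distrlr /= pair_big /=.
apply: eq_big => [[P1 P2]|[P1 P2]] /=; last first.
  rewrite /glue /= => /andP[/and3P[/andP[/partition_blocksP[P0 _ _ _] _] _ _]].
  move=> /eqP[e1 e2].
  rewrite -bigU /=; first by apply: eq_bigl => B; rewrite !inE.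
    apply/pred0P => B /=; apply/negP => /andP[PB1 PB2].
    have /set0Pn[x Bx] : B != set0 by apply: P0; rewrite inE PB1.
    have sB1 : B \subset S1 by move: PB1; rewrite -e1 !inE => /andP[].
    have sB2 : B \subset S2 by move: PB2; rewrite -e2 !inE => /andP[].
    by apply: (dis12 x); [apply: (subsetP sB1)|apply: (subsetP sB2)].
rewrite /glue /cut /=; apply/idP/idP.
  case/andP => /and3P[/andP[/partition_blocksP[P0 PS SP tiP] /noncrossingP ncP]].
  move=> /forall_inP splitP Q2 /eqP[e1 e2].
  rewrite e2 in Q2; rewrite Q2 andbT.
  set P := P1 :|: P2 in P0 PS SP tiP ncP splitP e1 e2.
  clearbody P.
  have nc_cut T : noncrossing (P ::&: T).
    apply/noncrossingP => B B' a b c d.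
    rewrite !inE => /andP[PB _] /andP[PB' _]; exact: (ncP B B' a b c d).
  have part_cut (T : {set 'I_m}) : (forall x, x \in T -> x \in S1 :|: S2) ->
      (forall B x, B \in P -> x \in B -> x \in T -> B \subset T) ->
      partition (P ::&: T) T.
    move=> sTS sBT; apply/partition_blocksP; split.
    - by move=> B; rewrite inE => /andP[/P0].
    - by move=> B x; rewrite !inE => /andP[_ /subsetP]; apply.
    - move=> x Tx; have [B PB Bx] := SP x (sTS x Tx).
      by exists B; rewrite // !inE PB (sBT B x).
    - by move=> B B' x; rewrite !inE => /andP[PB _] /andP[PB' _]; apply: tiP.
  rewrite -e1 -e2 /nc_on !nc_cut !andbT; apply/andP.
  split; apply: part_cut => [x|B x PB Bx]; rewrite ?inE => Sx; rewrite ?Sx ?orbT //.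
    case/orP: (splitP B PB) => // /subsetP/(_ x Bx) S2x.
    by case: (dis12 x).
  case/orP: (splitP B PB) => // /subsetP/(_ x Bx) S1x.
  by case: (dis12 x).
case/and3P => /andP[/partition_blocksP[P10 PS1 SP1 tiP1] /noncrossingP ncP1].
case/andP => /partition_blocksP[P20 PS2 SP2 tiP2] /noncrossingP ncP2 Q2.
have e1 : (P1 :|: P2) ::&: S1 = P1.
  apply/setP => B; rewrite !inE; apply/andP/idP => [[/orP[]//]|PB].
    move=> PB /subsetP sB1; case/set0Pn: (P20 B PB) => x Bx.
    by case: (dis12 x (sB1 x Bx)); apply: PS2 Bx.
  by rewrite PB; split=> //; apply/subsetP => x; apply: PS1.
have e2 : (P1 :|: P2) ::&: S2 = P2.
  apply/setP => B; rewrite !inE; apply/andP/idP => [[/orP[]//]|PB].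
    move=> PB /subsetP sB2; case/set0Pn: (P10 B PB) => x Bx.
    by case: (dis12 x) => //; [apply: PS1 Bx|apply: sB2].
  by rewrite PB orbT; split=> //; apply/subsetP => x; apply: PS2.
rewrite e1 e2 Q2 eqxx !andbT; apply/andP; split; last first.
  apply/forall_inP => B; rewrite inE => /orP[] PB; apply/orP; [left|right].
    by apply/subsetP => x; apply: PS1.
  by apply/subsetP => x; apply: PS2.
have dis12B B B' x : B \in P1 -> B' \in P2 -> x \in B -> x \in B' -> False.
  by move=> PB PB' /(PS1 _ _ PB) S1x /(PS2 _ _ PB'); apply: dis12.
apply/andP; split.
  apply/partition_blocksP; split.
  - by move=> B; rewrite inE => /orP[/P10|/P20].
  - by move=> B x; rewrite !inE => /orP[PB /(PS1 _ _ PB)->|PB /(PS2 _ _ PB)->];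
      rewrite ?orbT.
  - move=> x; rewrite inE => /orP[/SP1[B PB Bx]|/SP2[B PB Bx]];
      by exists B; rewrite // inE PB ?orbT.
  - move=> B B' x; rewrite !inE => /orP[]PB /orP[]PB' Bx B'x.
    + exact: tiP1 Bx B'x.
    + by case: (dis12B B B' x).
    + by case: (dis12B B' B x).
    + exact: tiP2 Bx B'x.
apply/noncrossingP => B B' a b c d.
rewrite !inE => /orP[]PB /orP[]PB' Ba B'b Bc B'd ab bc cd.
- exact: (ncP1 _ _ a b c d).
- case: (conv a b c); rewrite ?ab ?bc //; [exact: PS1 Ba|exact: PS2 B'b|exact: PS1 Bc].
- case: (conv b c d); rewrite ?cd ?bc //; [exact: PS1 B'b|exact: PS2 Bc|exact: PS1 B'd].
- exact: (ncP2 _ _ a b c d).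
Qed.

End NCSums.

(** * The first-block recursion *)

Section FirstBlock.
Variable F : comNzRingType.
Implicit Types (kappa M : nat -> F).

(** The sum over noncrossing configurations of an open block that already has r
    points, of a gap of j passed points after its last point, and of n points to
    come, where M gives the total weight of a gap. The next point either
    joins the gap, or joins the block; then the gap is complete and contributes
    M j. This one-point-at-a-time form of the recursion on the first block
    avoids sums over compositions, and it is the form in which words are read
    letter by letter below. *)
Fixpoint open_block_sum kappa M n r j : F :=
  if n is n'.+1 then
    open_block_sum kappa M n' r j.+1 + M j * open_block_sum kappa M n' r.+1 0
  else kappa r * M j.

Section Interval.
Variable m : nat.
Implicit Types (P : {set {set 'I_m}}) (B : {set 'I_m}).

Definition interval a b : {set 'I_m} := [set i : 'I_m | (a <= i < b)%N].

Definition below c B : {set 'I_m} := [set i in B | (i < c)%N].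

(** The blocks are weighted freely, and the block that is being built is known to
    meet the points below c exactly in B0. *)
Definition open_sum (f : {set 'I_m} -> F) B0 a c b : F :=
  \sum_(P | nc_on (B0 :|: interval a b) P && [exists B in P, below c B == B0])
    \prod_(B in P) f B.

(** At c = b the block is B0 itself, and the rest is an arbitrary noncrossing
    partition of the gap. *)
Lemma open_sum_end f B0 a b : B0 != set0 -> (forall i, i \in B0 -> (i < a)%N) ->
  (a <= b)%N -> open_sum f B0 a b b = f B0 * nc_sum f (interval a b).
Proof.
move=> B0n B0a le_ab.
pose Q P := B0 \in P.
have -> : f B0 = \sum_(P | nc_on B0 P && Q P) \prod_(B in P) f B.
  rewrite (big_pred1 [set B0]) ?big_set1 // => P; apply/idP/eqP.
    case/andP => /andP[/partition_blocksP[P0 PS _ tiP] _] PB0.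
    apply/setP => B; rewrite inE; apply/idP/eqP => [PB|->] //.
    have /set0Pn[x Bx] := P0 B PB; apply: (tiP _ _ x) => //; exact: PS Bx.
  move=> ->; rewrite /Q inE eqxx andbT; apply/andP; split.
    apply/partition_blocksP; split=> [B|B x|x B0x|B B' x].
    - by move/set1P->.
    - by move/set1P->.
    - by exists B0; rewrite ?inE.
    - by move=> /set1P-> /set1P->.
  by apply/noncrossingP => B B' ? ? ? ? /set1P-> /set1P->.
rewrite mulrC -nc_sum_glue; first last.
- move=> x y z; rewrite !inE => /andP[a_x _] /B0a; lia.
- move=> x; rewrite inE => /andP[a_x _] /B0a; lia.
apply: eq_bigl => P; rewrite [interval a b :|: B0]setUC.
case ncP: (nc_on _ P) => //=.
case/andP: ncP => /partition_blocksP[_ PS _ tiP] _.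
apply/exists_inP/andP => [[B PB /eqP defB]|[_ QP]].
  have {}defB : B = B0.
    rewrite -defB; apply/setP => x; rewrite inE; apply/esym/andb_idr => Bx.
    by have := PS B x PB Bx; rewrite !inE => /orP[/B0a|/andP[]]; lia.
  rewrite defB in PB; split; last by rewrite /Q !inE PB /=.
  apply/forall_inP => B' PB'.
  have [->|neqB] := eqVneq B' B0; first by rewrite subxx orbT.
  apply/orP; left; apply/subsetP => x B'x; have := PS B' x PB' B'x.
  by rewrite inE => /orP[B0x|//]; case/eqP: neqB; apply: (tiP _ _ x).
exists B0; first by move: QP; rewrite /Q !inE => /andP[].
apply/eqP/setP => x; rewrite inE; apply: andb_idr => /B0a; lia.
Qed.

(** If the open block takes c, then every other block that meets the gap [a, c[
    stays inside it, since B0 lies before the gap and c after it; so the gap can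
    be cut off. *)
Lemma open_sum_step f B0 a (c : 'I_m) b :
  B0 != set0 -> (forall i, i \in B0 -> (i < a)%N) -> (a <= c < b)%N ->
  open_sum f B0 a c b = open_sum f B0 a c.+1 b
    + nc_sum f (interval a c) * open_sum f (c |: B0) c.+1 c.+1 b.
Proof.
move=> B0n B0a /andP[le_ac lt_cb].
have belowS B : below c.+1 B = if c \in B then c |: below c B else below c B.
  case: ifP => cB; apply/setP => i; rewrite !inE.
    case: (eqVneq i c) => [->|neq]; first by rewrite cB ltnSn.
    by rewrite ltnS leq_eqVlt val_eqE (negPf neq).
  case: (eqVneq i c) => [->|neq]; first by rewrite cB.
  by rewrite ltnS leq_eqVlt val_eqE (negPf neq).
have cB0 : c \notin B0 by apply/negP => /B0a; lia.
rewrite /open_sum.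
rewrite (bigID (fun P => [exists B in P, below c.+1 B == B0])) /=; congr (_ + _).
  apply: eq_bigl => P; rewrite -andbA; congr (_ && _).
  apply: andb_idl => /exists_inP[B PB /eqP defB]; apply/exists_inP; exists B => //.
  move: defB; rewrite belowS; case: ifP => [_ defB|_ -> //].
  by rewrite -defB setU11 in cB0.
rewrite -nc_sum_glue; first last.
- move=> x y z; rewrite !inE => /andP[? ?].
  by case/orP=> [/predU1P[->|/B0a]|] ? /andP[? ?]; lia.
- by move=> x; rewrite !inE => /andP[? ?] /orP[/predU1P[eq_xc|/B0a]|]; subst; lia.
have defS : interval a c :|: ((c |: B0) :|: interval c.+1 b) = B0 :|: interval a b.
  apply/setP => i; rewrite !inE; have [->|neq] := eqVneq i c.
    by rewrite le_ac lt_cb !orbT.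
  have {}neq : (i : nat) != c by [].
  by case: (i \in B0); rewrite ?orbT //=; lia.
rewrite defS; apply: eq_bigl => P; rewrite -andbA.
case ncP: (nc_on _ P) => //=.
case/andP: ncP => /partition_blocksP[_ PS _ tiP] /noncrossingP ncP.
case/set0Pn: B0n => z B0z.
apply/andP/andP => [[/exists_inP[B PB /eqP defB] nB]|[_ /exists_inP[B]]].
  have cB : c \in B.
    apply: contraR nB => cB; apply/exists_inP; exists B => //.
    by rewrite belowS (negPf cB) defB.
  have Bz : z \in B by move: B0z; rewrite -defB inE => /andP[].
  have sB2 : B \subset (c |: B0) :|: interval c.+1 b.
    apply/subsetP => x Bx; rewrite -defB !inE Bx /=.
    have [//|neq /=] := eqVneq x c; have {}neq : (x : nat) != c by [].
    have := PS B x PB Bx; rewrite !inE => /orP[/B0a|/andP[_ ->]].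
      by move/leq_trans/(_ le_ac)->.
    by rewrite andbT; case: ltngtP neq => // ->; rewrite eqxx.
  split; last first.
    apply/exists_inP; exists B; last by rewrite belowS cB defB.
    by rewrite !inE PB.
  apply/forall_inP => B' PB'.
  have [->|neqB] := eqVneq B' B; first by rewrite sB2 orbT.
  rewrite orbC; case: (boolP (B' \subset _)) => //= /subsetPn[y B'y S2y].
  apply/subsetP => x B'x; rewrite inE.
  move: S2y; rewrite !inE !negb_or -andbA => /and3P[neq_yc B0y nS2y].
  have /andP[le_ay lt_yb] : (a <= y < b)%N.
    by have := PS B' y PB' B'y; rewrite !inE (negPf B0y).
  have lt_yc : (y < c)%N.
    by rewrite ltn_neqAle neq_yc leqNgt; rewrite lt_yb andbT in nS2y.
  have := PS B' x PB' B'x; rewrite !inE => /orP[B0x|/andP[-> _]] /=.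
    case/eqP: neqB; apply: (tiP _ _ x) => //.
    by move: B0x; rewrite -defB inE => /andP[].
  rewrite ltnNge leq_eqVlt; apply/negP => /predU1P[/val_inj eq_cx|lt_cx].
    by case/eqP: neqB; apply: (tiP _ _ x); rewrite -?eq_cx // eq_cx.
  (* otherwise B', which has a point y in the gap and a point x past c, would
     cross B through z in B0 and c *)
  case/eqP: neqB; apply/esym; apply: (ncP B B' z y c x) => //.
  exact: leq_trans (B0a z B0z) le_ay.
rewrite !inE => /andP[PB _] /eqP defB.
have cB : c \in B by have := setU11 c B0; rewrite -defB inE => /andP[].
have Bz : z \in B by have := setU1r c B0z; rewrite -defB inE => /andP[].
have defB0 : below c B = B0.
  move: defB; rewrite belowS cB => /(congr1 (fun S => S :\ c)).
  by rewrite !setU1K // inE ltnn andbF.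
split; first by apply/exists_inP; exists B; rewrite ?defB0.
apply/exists_inP => -[B' PB' /eqP defB'].
have eqB : B' = B.
  by apply: (tiP _ _ z) => //; move: B0z; rewrite -defB' inE => /andP[].
by move: cB0; rewrite -defB' eqB defB setU11.
Qed.


Lemma open_sumE (kappa M : nat -> F) n :
    (forall a k, (k <= n)%N -> (a + k <= m)%N ->
       nc_sum (fun B => kappa #|B|) (interval a (a + k)) = M k) ->
  forall k B0 a j, B0 != set0 -> (forall i, i \in B0 -> (i < a)%N) ->
    (a + j + k <= m)%N -> (j + k <= n)%N ->
  open_sum (fun B => kappa #|B|) B0 a (a + j) (a + j + k)
    = open_block_sum kappa M k #|B0| j.
Proof.
move=> defM; elim=> [|k IHk] B0 a j B0n B0a le_m le_n /=.
  by rewrite addn0 open_sum_end ?leq_addr // defM //; lia.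
have lt_cm : (a + j < m)%N by lia.
rewrite (@open_sum_step _ _ _ (Ordinal lt_cm)) /=; try by [|lia].
rewrite defM; try lia.
rewrite -(IHk B0 a j.+1) //; try lia.
have cB0 : Ordinal lt_cm \notin B0 by apply/negP => /B0a /=; lia.
have -> : #|B0|.+1 = #|Ordinal lt_cm |: B0| by rewrite cardsU1 cB0.
rewrite -(IHk _ (a + j).+1 0) ?addn0; try lia.
- by rewrite addnS !addSn addnS.
- by apply/set0Pn; exists (Ordinal lt_cm); rewrite setU11.
- by move=> i /setU1P[->//|/B0a]; lia.
Qed.

Lemma nc_sum_open (f : {set 'I_m} -> F) a n (lt_am : (a < m)%N) :
  nc_sum f (interval a (a + n.+1))
    = open_sum f [set Ordinal lt_am] a.+1 a.+1 (a.+1 + n).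
Proof.
have defS : [set Ordinal lt_am] :|: interval a.+1 (a.+1 + n) =
    interval a (a + n.+1).
  apply/setP => i; rewrite !inE; have [->|neq] := eqVneq i (Ordinal lt_am).
    by rewrite /= leqnn; lia.
  by have {}neq : (i : nat) != a by []; rewrite /=; lia.
rewrite /open_sum /nc_sum defS; apply: eq_bigl => P; apply/esym/andb_idr.
case/andP => /partition_blocksP[_ PS SP _] _.
have [|B PB Ba] := SP (Ordinal lt_am); first by rewrite inE /=; lia.
apply/exists_inP; exists B => //; apply/eqP/setP => i; rewrite !inE.
apply/andP/eqP => [[Bi]|->]; last by split; rewrite //= ltnSn.
by have := PS B i PB Bi; rewrite inE => ? ?; apply: val_inj => /=; lia.
Qed.

Lemma nc_sum0 (f : {set 'I_m} -> F) : nc_sum f set0 = 1.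
Proof.
rewrite /nc_sum (big_pred1 set0) ?big_set0 // => P; apply/idP/eqP.
  case/andP => /partition_blocksP[P0 PS _ _] _; apply/setP => B; rewrite !inE.
  apply/negP => PB; case/set0Pn: (P0 B PB) => x Bx.
  by have := PS B x PB Bx; rewrite inE.
move->; apply/andP; split.
  by apply/partition_blocksP; split=> [B|B x|x|B B' x]; rewrite inE.
by apply/noncrossingP => B B' ? ? ? ?; rewrite inE.
Qed.

End Interval.

Lemma nc_sum_setT kappa n :
  nc_sum (fun B : {set 'I_n} => kappa #|B|) [set: 'I_n]
    = cumulants_to_moments kappa n.
Proof. by []. Qed.

Lemma intervalT n : interval n 0 n = setT.
Proof. by apply/setP => i; rewrite !inE /= ltn_ord. Qed.

Lemma cumulants_to_moments0 kappa : cumulants_to_moments kappa 0 = 1.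
Proof.
rewrite -nc_sum_setT; have -> : [set: 'I_0] = set0 by apply/setP => -[].
exact: nc_sum0.
Qed.

(** The hypothesis is a form of translation invariance for shorter intervals; it is
    the induction hypothesis of the next lemma. *)
Lemma nc_sum_first_block kappa m a n :
    (forall b k, (k <= n)%N -> (b + k <= m)%N ->
       nc_sum (fun B => kappa #|B|) (interval m b (b + k))
         = cumulants_to_moments kappa k) ->
    (a + n.+1 <= m)%N ->
  nc_sum (fun B => kappa #|B|) (interval m a (a + n.+1))
    = open_block_sum kappa (cumulants_to_moments kappa) n 1 0.
Proof.
move=> defM le_m; have lt_am : (a < m)%N by lia.
rewrite (nc_sum_open _ _ lt_am) -[a.+1 in X in open_sum _ _ _ X]addn0.
rewrite -[a.+1 in X in open_sum _ _ _ _ X]addn0.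
rewrite (open_sumE defM) ?cards1 //.
- by apply/set0Pn; exists (Ordinal lt_am); rewrite inE.
- by move=> i /set1P->.
- by lia.
Qed.

(** Translation invariance follows from the recursion, whose right-hand side
    does not mention the position a or the ambient size m. *)
Lemma nc_sum_interval kappa n m a : (a + n <= m)%N ->
  nc_sum (fun B => kappa #|B|) (interval m a (a + n))
    = cumulants_to_moments kappa n.
Proof.
elim/ltn_ind: n m a => -[_|n IHn] m a le_m.
  rewrite cumulants_to_moments0; have -> : interval m a (a + 0) = set0.
    by apply/setP => i; rewrite !inE; lia.
  exact: nc_sum0.
have first_block p b : (b + n.+1 <= p)%N ->
    nc_sum (fun B => kappa #|B|) (interval p b (b + n.+1)) =
    open_block_sum kappa (cumulants_to_moments kappa) n 1 0.
  by apply: nc_sum_first_block => c k le_kn; apply: IHn.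
rewrite first_block // -nc_sum_setT -intervalT.
exact/esym/(first_block _ 0%N).
Qed.

(** The moment-cumulant formula as a recursion on the block of the first
    point. *)
Lemma cumulants_to_moments_first_block kappa n :
  cumulants_to_moments kappa n.+1
    = open_block_sum kappa (cumulants_to_moments kappa) n 1 0.
Proof.
rewrite -nc_sum_setT -intervalT.
apply: (@nc_sum_first_block kappa n.+1 0 n) => // b k _.
exact: nc_sum_interval.
Qed.

End FirstBlock.

Lemma open_block_sumZ (F : comNzRingType) c (kappa M : nat -> F) n r k :
  open_block_sum (fun r => c * kappa r) M n r k = c * open_block_sum kappa M n r k.
Proof.
elim: n r k => [|n IHn] r k /=; first by rewrite mulrA.
by rewrite !IHn; ring.
Qed.

(** * Free cumulants of dilations *)

Section Cumulants.
Variable F : comNzRingType.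

Lemma eq_cumulants_to_moments (kappa kappa' : nat -> F) :
    (forall r, (0 < r)%N -> kappa r = kappa' r) ->
  cumulants_to_moments kappa =1 cumulants_to_moments kappa'.
Proof.
move=> eqk n; apply: eq_bigr => P /andP[/partition_blocksP[P0 _ _ _] _].
by apply: eq_bigr => B PB; rewrite eqk // card_gt0 P0.
Qed.

(** The moment-cumulant formula is homogeneous: the block sizes of a partition of
    r points add up to r. *)
Lemma free_cumulant_dilation c (mu : nat -> F) r :
  free_cumulant (dilation c mu) r = c ^+ r * free_cumulant mu r.
Proof.
elim/ltn_ind: r => r IHr; rewrite !free_cumulantE mulrBr /dilation mulr_sumr.
congr (_ - _); apply: eq_bigr => P /andP[ncP nP1].
have /andP[partP _] := ncP.
have -> : c ^+ r = \prod_(B in P) c ^+ #|B|.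
  rewrite -(big_morph (fun k => c ^+ k) (exprD c) (expr0 c)).
  by rewrite -(card_partition partP) cardsT card_ord.
rewrite -big_split /=; apply: eq_bigr => B PB.
by apply: IHr; apply: nc_partition_block_lt PB.
Qed.

End Cumulants.

(** * The Schwinger-Dyson equation of a free element *)

Section SchwingerDyson.
Variables (C : fieldType) (E : pzRingType) (phi : E -> C).
Variable j : {rmorphism C -> E}.
Hypothesis jC : forall c x, j c * x = x * j c.
Hypothesis phiD : forall x y, phi (x + y) = phi x + phi y.
Hypothesis phiZ : forall c x, phi (j c * x) = c * phi x.
Hypothesis phi1 : phi 1 = 1.
Variable S : bool -> E -> Prop.
Hypothesis S_scalar : forall t c, S t (j c).
Hypothesis S_add : forall t x y, S t x -> S t y -> S t (x + y).
Hypothesis S_mul : forall t x y, S t x -> S t y -> S t (x * y).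
Hypothesis S_free : freely_independent phi S.
Variables (X : E) (kappa : nat -> C).
Hypothesis S_X : S true X.
Hypothesis moments_X :
  forall n, phi (X ^+ n) = cumulants_to_moments kappa n.

Lemma phi_scalar c : phi (j c) = c.
Proof. by rewrite -[j c]mulr1 phiZ phi1 mulr1. Qed.

Lemma S_1 t : S t 1. Proof. by rewrite -(rmorph1 j). Qed.

Definition center x : E := x + j (- phi x).

Lemma S_center t x : S t x -> S t (center x).
Proof. by move=> Sx; apply: S_add. Qed.

Lemma phi_center x : phi (center x) = 0.
Proof. by rewrite phiD phi_scalar subrr. Qed.

Lemma centerK x : x = j (phi x) * 1 + center x.
Proof. by rewrite /center mulr1 addrCA -rmorphD subrr rmorph0 addr0. Qed.

(** Products of centered elements taken alternately from S true and S false; the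
    index is the side of the last factor. *)
Inductive alternating : bool -> E -> Prop :=
| Alternating_one t a : S t a -> phi a = 0 -> alternating t a
| Alternating_snoc t x a : alternating (~~ t) x -> S t a -> phi a = 0 ->
    alternating t (x * a).

Lemma alternating_prod t x : alternating t x ->
  exists n (i : nat -> bool) (a : nat -> E),
    [/\ i n = t, forall k, (k < n)%N -> i k <> i k.+1,
        forall k, (k <= n)%N -> S (i k) (a k) /\ phi (a k) = 0
      & x = \prod_(k < n.+1) a k].
Proof.
elim=> {t x} [t a Sa a0|t x a _ [n [i [b [it ialt Sb ->]]]] Sa a0].
  exists 0%N, (fun=> t), (fun=> a); split=> //.
  by rewrite big_ord_recr big_ord0 /= mul1r.
exists n.+1, (fun k => if (k <= n)%N then i k else t),
  (fun k => if (k <= n)%N then b k else a); split.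
- by rewrite ltnn.
- move=> k; rewrite ltnS => le_kn; rewrite le_kn; case: ltnP => [/ialt //|le_nk].
  have -> : k = n by apply/eqP; rewrite eqn_leq le_kn.
  by rewrite it; case: (t).
- by move=> k le_k; case: leqP => [/Sb|].
rewrite [RHS]big_ord_recr /= ltnn; congr (_ * _).
by apply: eq_bigr => k _; rewrite -ltnS ltn_ord.
Qed.

Lemma phi_alternating t x : alternating t x -> phi x = 0.
Proof.
case/alternating_prod => n [i [a [_ ialt Sa ->]]].
by apply: (S_free (i := i)) => // k /Sa[].
Qed.

Implicit Types f g : nat -> E -> C.

(** A word is read from left to right by operators on functions f of (r, x), where
    r is the number of letters in the open block and x is the value of the word
    between the last of them and the current position. Reading X either extends
    x or puts X into the block, and then x contributes phi x; at the end
    of the word the block is closed with weight kappa r. Applied to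
    close_block, the operators of the letters of Q produce a function whose value
    at (1, 1) is the sum over marked letters in the Schwinger-Dyson equation.
    Operators make sense for polynomials in X as well, although the marked
    letters are not determined by the value of a word in E. *)
Definition op_X f : nat -> E -> C :=
  fun r x => f r (x * X) + phi x * f r.+1 1.

Definition op_left b f : nat -> E -> C := fun r x => f r (x * b).

Definition close_block : nat -> E -> C := fun r x => kappa r * phi x.

Definition linear_acc f := forall r c x y, f r (j c * x + y) = c * f r x + f r y.

Lemma linear_close_block : linear_acc close_block.
Proof. by move=> r c x y; rewrite /close_block phiD phiZ; ring. Qed.

Lemma linear_op_X f : linear_acc f -> linear_acc (op_X f).
Proof. by move=> fL r c x y; rewrite /op_X mulrDl -mulrA fL phiD phiZ; ring. Qed.

Lemma linear_op_left b f : linear_acc f -> linear_acc (op_left b f).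
Proof. by move=> fL r c x y; rewrite /op_left mulrDl -mulrA fL. Qed.

(** Monic polynomials in X together with the corresponding polynomials in
    op_X, by Horner's scheme. Centered monic polynomials suffice as letters: they
    are what is left of X * p once its expectation is subtracted. *)
Inductive monic_X : E -> ((nat -> E -> C) -> nat -> E -> C) -> Prop :=
| Monic_1 : monic_X 1 id
| Monic_horner c p F : monic_X p F ->
    monic_X (X * p + j c) (fun f r x => op_X (F f) r x + c * f r x).

Lemma S_monic p F : monic_X p F -> S true p.
Proof.
elim=> {p F} [|c p F _ Sp]; first exact: S_1.
by apply: S_add => //; apply: S_mul.
Qed.

Lemma linear_monic p F f : monic_X p F -> linear_acc f -> linear_acc (F f).
Proof.
move=> pF fL; elim: pF => {p F} [|c p F _ IH] // r c' x y.
by rewrite (linear_op_X IH) fL; ring.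
Qed.

(** Alternating words q in centered letters, paired with the function f that their
    operators produce from close_block. The index is the side of the first
    letter; the empty word has both indices. *)
Inductive alt_pair : bool -> E -> (nat -> E -> C) -> Prop :=
| Alt_nil t : alt_pair t 1 close_block
| Alt_left b q f : S false b -> phi b = 0 -> alt_pair true q f ->
    alt_pair false (b * q) (op_left b f)
| Alt_X p F q f : monic_X p F -> phi p = 0 -> alt_pair false q f ->
    alt_pair true (p * q) (F f).

Lemma linear_alt t q f : alt_pair t q f -> linear_acc f.
Proof.
elim=> {t q f} [_|b q f _ _ _|p F q f pF _ _].
- exact: linear_close_block.
- exact: linear_op_left.
- exact: linear_monic pF.
Qed.

Lemma phi_alternating_S x s :
  alternating false x -> S true s -> phi (x * s) = 0.
Proof.
move=> xA Ss; rewrite (centerK s) mulrDr mulr1 -jC phiD phiZ.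
rewrite (phi_alternating xA) mulr0 add0r.
by apply: phi_alternating (@Alternating_snoc true _ _ xA (S_center Ss) (phi_center s)).
Qed.

(** Marking a letter of p leaves a factor phi (x * s) with s in the algebra of X,
    which vanishes; only the term without marks survives. *)
Lemma monic_alternating p F f x u r : monic_X p F -> linear_acc f ->
  alternating false x -> S true u -> F f r (x * u) = f r (x * u * p).
Proof.
move=> pF fL xA; elim: pF u => {p F} [|c p F pF IH] u Su; first by rewrite mulr1.
rewrite /op_X -mulrA IH; last exact: S_mul.
rewrite phi_alternating_S // mul0r addr0.
by rewrite mulrDr -jC [_ + j c * _]addrC fL addrC !mulrA.
Qed.

(** If x * q is an alternating product, then no mark contributes: each mark would
    cut off an alternating product on its left. *)
Lemma alt_pair_zero t q f x : alt_pair t q f -> alternating (~~ t) x ->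
  phi (x * q) = 0 /\ forall r, f r x = 0.
Proof.
move=> qf; elim: qf x => {t q f} [t|b q f Sb b0 _ IH|p F q f pF p0 qf IH] x xA.
- by rewrite mulr1 /close_block (phi_alternating xA); split=> // r; rewrite mulr0.
- have [] := IH (x * b); first exact: Alternating_snoc.
  by rewrite mulrA.
have [] := IH (x * p).
  by apply: Alternating_snoc => //; apply: S_monic pF.
rewrite mulrA => -> fxp; split=> // r.
rewrite -[x]mulr1 (monic_alternating _ pF (linear_alt qf) xA (S_1 _)).
by rewrite mulr1 fxp.
Qed.

(** A word whose first letter lies in S false keeps both
    expressions equal to zero even after multiplication by any element of the
    algebra of X, centered or not. *)
Lemma alt_left_zero b q f s : S false b -> phi b = 0 -> alt_pair true q f ->
  S true s -> phi (s * (b * q)) = 0 /\ forall r, op_left b f r s = 0.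
Proof.
move=> Sb b0 qf Ss.
have bA : alternating false b by apply: Alternating_one.
have sA : alternating true (center s).
  by apply: Alternating_one; [apply: S_center|apply: phi_center].
have [q0 f0] := alt_pair_zero qf bA.
have [sq0 sf0] := alt_pair_zero (Alt_left Sb b0 qf) sA.
rewrite (centerK s) mulrDl -mulrA mul1r phiD phiZ q0 sq0 mulr0 addr0; split=> // r.
rewrite (linear_op_left b (linear_alt qf)) sf0 /op_left mul1r f0.
by rewrite mulr0 addr0.
Qed.

Lemma monic_zero p F f s r : monic_X p F ->
  (forall r s, S true s -> f r s = 0) -> S true s -> F f r s = 0.
Proof.
move=> pF f0; elim: pF s r => {p F} [|c p F _ IH] s r Ss; first exact: f0.
by rewrite /op_X !IH ?f0 ?mulr0 ?addr0 //; [apply: S_1|apply: S_mul].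
Qed.

Lemma iter_op_X_linear n c f g h : (forall r x, h r x = f r x + c * g r x) ->
  forall r x, iter n op_X h r x = iter n op_X f r x + c * iter n op_X g r x.
Proof.
move=> eqh; elim: n => [|n IHn] r x //=.
by rewrite /op_X !IHn; ring.
Qed.

Lemma iter_op_X_close n r k :
  iter n op_X close_block r (X ^+ k)
    = open_block_sum kappa (cumulants_to_moments kappa) n r k.
Proof.
elim: n r k => [|n IHn] r k /=; first by rewrite /close_block moments_X.
by rewrite /op_X -exprSr IHn moments_X -[1]/(X ^+ 0) IHn.
Qed.

Lemma monic_close p F : monic_X p F ->
  forall n, phi (X ^+ n.+1 * p) = iter n op_X (F close_block) 1 1.
Proof.
elim=> {p F} [|c p F _ IH] n.
  rewrite mulr1 moments_X cumulants_to_moments_first_block -iter_op_X_close.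
  by [].
rewrite (@iter_op_X_linear _ c (op_X (F close_block)) close_block) //.
rewrite -iterSr -IH mulrDr phiD mulrA -exprSr -jC phiZ; congr (_ + _ * _).
by rewrite moments_X cumulants_to_moments_first_block -iter_op_X_close.
Qed.

(** Linear span of the alternating pairs. The functions are compared pointwise. *)
Inductive span_pair : E -> (nat -> E -> C) -> Prop :=
| Span_alt t q f : alt_pair t q f -> span_pair q f
| Span_lin c q f q' f' g : span_pair q f -> span_pair q' f' ->
    (forall r x, g r x = c * f r x + f' r x) -> span_pair (j c * q + q') g.

Lemma linear_span q f : span_pair q f -> linear_acc f.
Proof.
elim=> {q f} [t q f /linear_alt//|c q f q' f' g _ fL _ f'L eqg] r c' x y.
by rewrite !eqg fL f'L; ring.
Qed.

(** By linearity only alternating words matter. If the word contains a letter from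
    S false, both sides vanish by alt_left_zero and monic_zero; otherwise it is a
    polynomial in X and monic_close applies. *)
Theorem schwinger_dyson q f : span_pair q f -> phi (X * q) = f 1%N 1.
Proof.
elim=> {q f} [t q f|c q f q' f' g _ IH _ IH' ->]; last first.
  by rewrite mulrDr mulrA -jC -mulrA phiD phiZ IH IH'.
have nil : phi (X * 1) = close_block 1 1 by exact: (monic_close Monic_1 0).
case=> {t q f} [_|b q f Sb b0 qf|p F q f pF p0 qf] //.
  have [-> _] := alt_left_zero Sb b0 qf S_X.
  by have [_ ->] := alt_left_zero Sb b0 qf (S_1 true).
have Sp := S_monic pF.
case: {-2}_ _ _ / qf (erefl false) => [t _|b q' f' Sb b0 qf' _|//].
  by rewrite mulr1; have := monic_close pF 0; rewrite expr1.
rewrite mulrA; have [-> _] := alt_left_zero Sb b0 qf' (S_mul S_X Sp).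
rewrite (monic_zero _ pF) //; last exact: S_1.
by move=> r s Ss; have [_ ->] := alt_left_zero Sb b0 qf' Ss.
Qed.

(** The span is closed under multiplication by X: the product of X with a first
    letter p is the sum of its expectation, which leaves a shorter alternating
    word, and of a centered polynomial. *)
Lemma span_X q f : span_pair q f -> span_pair (X * q) (op_X f).
Proof.
elim=> {q f} [t q f|c q f q' f' g _ IH _ IH' eqg]; last first.
  rewrite mulrDr mulrA -jC -mulrA; apply: Span_lin IH IH' _ => r x.
  by rewrite /op_X !eqg; ring.
have left_case q0 f0 : alt_pair false q0 f0 -> span_pair (X * q0) (op_X f0).
  move=> qf.
  have pF := Monic_horner (- phi X) Monic_1.
  have -> : X * q0 = j (phi X) * q0 + (X * 1 + j (- phi X)) * q0.
    by rewrite -mulrDl mulr1 -/(center X) {1}(centerK X) mulr1.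
  apply: Span_lin (Span_alt qf) (Span_alt (Alt_X pF _ qf)) _.
    by rewrite mulr1 phi_center.
  by move=> r x /=; ring.
case=> {t q f} [_|b q f Sb b0 qf|p F q f pF p0 qf].
- exact/left_case/Alt_nil.
- exact/left_case/Alt_left.
have pF' := Monic_horner (- phi (X * p)) pF.
have -> : X * (p * q) = j (phi (X * p)) * q + (X * p + j (- phi (X * p))) * q.
  by rewrite -mulrDl mulrA; congr (_ * q); rewrite {1}(centerK (X * p)) mulr1.
apply: Span_lin (Span_alt qf) (Span_alt (Alt_X pF' _ qf)) _.
  by rewrite phi_center.
by move=> r x /=; ring.
Qed.

(** The same splitting into expectation and centered part, for letters in
    S false. *)
Lemma span_left b q f : S false b ->
  span_pair q f -> span_pair (b * q) (op_left b f).
Proof.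
move=> Sb; elim=> {q f} [t q f|c q f q' f' g _ IH _ IH' eqg]; last first.
  rewrite mulrDr mulrA -jC -mulrA; apply: Span_lin IH IH' _ => r x.
  by rewrite /op_left !eqg.
have true_case q0 f0 b' g : S false b' -> alt_pair true q0 f0 ->
    (forall r x, g r x = f0 r (x * b')) -> span_pair (b' * q0) g.
  move=> Sb' qf eqg; rewrite {1}(centerK b') mulrDl mulr1.
  apply: Span_lin (Span_alt qf)
    (Span_alt (Alt_left (S_center Sb') (phi_center b') qf)) _ => r x.
  by rewrite eqg {1}(centerK b') mulrDr mulr1 -jC (linear_alt qf).
case=> {t q f} [_|b' q f Sb' b0 qf|p F q f pF p0 qf].
- by apply: true_case => //; apply: Alt_nil.
- rewrite mulrA; apply: (true_case _ _ _ _ (S_mul Sb Sb') qf) => r x.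
  by rewrite /op_left mulrA.
- by apply: true_case => //; apply: Alt_X.
Qed.

Lemma span_sum (I : Type) (l : seq I) (q : I -> E) (f : I -> nat -> E -> C) :
    (forall i, span_pair (q i) (f i)) ->
  forall g, (forall r x, g r x = \sum_(i <- l) f i r x) ->
  span_pair (\sum_(i <- l) q i) g.
Proof.
move=> qf; elim: l => [|i l IHl] g eqg.
  have nil := Span_alt (Alt_nil true).
  (* zero is the difference of the empty word with itself *)
  have -> : \sum_(i <- [::]) q i = j (-1) * 1 + 1.
    by rewrite big_nil rmorphN rmorph1 mulr1 addNr.
  by apply: (Span_lin nil nil) => r x; rewrite eqg big_nil; ring.
rewrite big_cons -[q i]mul1r -(rmorph1 j).
apply: Span_lin (qf i) (IHl _ (fun r x => erefl)) _ => r x.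
by rewrite eqg big_cons mul1r.
Qed.

(** The letter Z = \sum_i b_i X c_i is read at once: it either extends x by Z, or
    its letter X is marked, which splits Z at this letter. *)
Definition op_sandwich (I : finType) (b c : I -> E) f : nat -> E -> C :=
  fun r x => f r (x * \sum_i b i * X * c i)
             + \sum_i phi (x * b i) * f r.+1 (c i).

Lemma linear_acc_sum (I : Type) (l : seq I) f r (x : I -> E) : linear_acc f ->
  f r (\sum_(i <- l) x i) = \sum_(i <- l) f r (x i).
Proof.
move=> fL; have f0 : f r 0 = 0.
  by have := fL r (-1) 0 0; rewrite mulr0 addr0 mulN1r addNr.
elim: l => [|i l IHl]; first by rewrite !big_nil.
by rewrite !big_cons -IHl -[x i]mul1r -(rmorph1 j) fL mul1r rmorph1 mul1r.
Qed.

Lemma span_sandwich (I : finType) (b c : I -> E) q f :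
    (forall i, S false (b i)) -> (forall i, S false (c i)) ->
  span_pair q f ->
  span_pair ((\sum_i b i * X * c i) * q) (op_sandwich b c f).
Proof.
move=> Sb Sc qf; rewrite mulr_suml.
have qfi i := span_left (Sb i) (span_X (span_left (Sc i) qf)).
under eq_bigr do rewrite -!mulrA.
apply: span_sum qfi _ _ => r x.
rewrite /op_left /op_X big_split /=; congr (_ + _).
  rewrite mulr_sumr (linear_acc_sum _ _ _ (linear_span qf)).
  by apply: eq_bigr => i _; rewrite !mulrA.
by apply: eq_bigr => i _; rewrite mul1r.
Qed.

Lemma schwinger_dyson_sandwich (I : finType) (b c : I -> E) u v n :
    (forall i, S false (b i)) -> (forall i, S false (c i)) ->
    S false u -> S false v ->
  phi (X * (u * ((\sum_i b i * X * c i) ^+ n * v))) =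
    iter n (op_sandwich b c) (op_left v close_block) 1%N u.
Proof.
move=> Sb Sc Su Sv.
have span_n : span_pair ((\sum_i b i * X * c i) ^+ n * v)
    (iter n (op_sandwich b c) (op_left v close_block)).
  elim: n => [|n IHn] /=.
    by rewrite mul1r; have := span_left Sv (Span_alt (Alt_nil true)); rewrite mulr1.
  by rewrite exprS -mulrA; apply: span_sandwich.
by rewrite (schwinger_dyson (span_left Su span_n)) /op_left mul1r.
Qed.

End SchwingerDyson.

(** * Matrices free from the scalar matrices *)

Section Matrices.
Variables (C : fieldType) (A : algType C) (tau : {scalar A}) (n : nat).
Hypothesis tau1 : tau 1 = 1.
Hypothesis n_neq0 : n%:R != 0 :> C.

Let phi : 'M[A]_n -> C := mx_functional tau.
(** 'M[A]_n is an algebra over A only; its scalars from C enter through j. *)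
Let j : {rmorphism C -> 'M[A]_n} := (@scalar_mx A n) \o in_alg A.

Let jE c : j c = c%:A%:M. Proof. by []. Qed.

Lemma mulmx_scalar_alg c (M : 'M[A]_n) p q : (j c * M) p q = c *: M p q.
Proof. by rewrite jE -mulmxE mul_scalar_mx mxE mulr_algl. Qed.

Lemma scalar_alg_central c (M : 'M[A]_n) : j c * M = M * j c.
Proof.
apply/matrixP => p q; rewrite mulmx_scalar_alg jE -mulmxE.
rewrite mxE (bigD1 q) //= big1 ?addr0 => [|k neq].
  by rewrite mxE eqxx mulr_algr.
by rewrite mxE (negPf neq) mulr0n mulr0.
Qed.

Lemma mx_functionalD M P : phi (M + P) = phi M + phi P.
Proof.
rewrite /phi /mx_functional -mulrDr -big_split; congr (_ * _).
by apply: eq_bigr => h _; rewrite mxE linearD.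
Qed.

Lemma mx_functionalZ c M : phi (j c * M) = c * phi M.
Proof.
rewrite /phi /mx_functional mulrCA; congr (_ * _); rewrite mulr_sumr.
by apply: eq_bigr => h _; rewrite mulmx_scalar_alg linearZ.
Qed.

Lemma mx_functional1 : phi 1 = 1.
Proof.
rewrite /phi /mx_functional (eq_bigr (fun=> 1)) => [|h _].
  by rewrite sumr_const card_ord mulVf.
by rewrite mxE eqxx tau1.
Qed.

Lemma delta_mx_mull p q (M : 'M[A]_n) i k :
  (delta_mx p q * M) i k = (i == p)%:R * M q k.
Proof.
rewrite -mulmxE mxE (bigD1 q) //= big1 => [|l neq]; last first.
  by rewrite mxE (negPf neq) andbF mul0r.
by rewrite mxE eqxx andbT addr0.
Qed.

Lemma delta_mx_mulr p q (M : 'M[A]_n) i k :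
  (M * delta_mx p q) i k = (k == q)%:R * M i p.
Proof.
rewrite -mulmxE mxE (bigD1 p) //= big1 => [|l neq]; last first.
  by rewrite mxE (negPf neq) mulr0.
by rewrite mxE eqxx addr0; case: (k == q); rewrite ?mul1r ?mulr1 // mul0r mulr0.
Qed.

Lemma delta_mx_mul2 p q p' q' (M : 'M[A]_n) i k :
  (delta_mx p q * M * delta_mx p' q') i k = ((i == p) && (k == q'))%:R * M q p'.
Proof. by rewrite delta_mx_mulr delta_mx_mull mulrA -natrM mulnb andbC. Qed.

Lemma delta_mx_mid p q (M P : 'M[A]_n) i k :
  (M * delta_mx p q * P) i k = M i p * P q k.
Proof.
rewrite -mulrA -mulmxE mxE (bigD1 p) //= big1 => [|l neq]; last first.
  by rewrite mulmxE delta_mx_mull (negPf neq) mul0r mulr0.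
by rewrite mulmxE delta_mx_mull eqxx mul1r addr0.
Qed.

Lemma tau_natl (b : bool) x : tau (b%:R * x) = b%:R * tau x.
Proof. by case: b; rewrite ?mul1r // !mul0r linear0. Qed.

Lemma mx_functional_delta_mx p q M :
  phi (M * delta_mx p q) = n%:R^-1 * tau (M q p).
Proof.
rewrite /phi /mx_functional; congr (_ * _).
rewrite (bigD1 q) //= big1 ?addr0 => [|h neq].
  by rewrite delta_mx_mulr eqxx mul1r.
by rewrite delta_mx_mulr (negPf neq) mul0r linear0.
Qed.

Lemma mx_functional_delta_mx2 p q p' q' M :
  phi (delta_mx p q * M * delta_mx p' q') =
    n%:R^-1 * ((p == q')%:R * tau (M q p')).
Proof. by rewrite mx_functional_delta_mx delta_mx_mull tau_natl eq_sym. Qed.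

Lemma scalar_entries_delta_mx p q : scalar_entries (delta_mx p q : 'M[A]_n).
Proof.
by exists (delta_mx p q); apply/matrixP => i k; rewrite !mxE; case: andb;
  rewrite ?rmorph1 ?rmorph0.
Qed.

Variables (X : 'M[A]_n) (kappa : nat -> C).
Hypothesis X_free : free_from_scalar_mx tau X.
Hypothesis moments_X :
  forall k, phi (X ^+ k) = cumulants_to_moments kappa k.

Let S b := if b then generated_algebra X else @scalar_entries C A n.

Let S_scalar t c : S t (j c).
Proof.
case: t => /=; first exact: Generated_scalar.
by exists c%:M; apply/matrixP => p q; rewrite !mxE; case: eqP;
  rewrite ?mulr1n ?mulr0n ?rmorph0.
Qed.

Let S_add t M P : S t M -> S t P -> S t (M + P).
Proof.
case: t => /=; first exact: Generated_add.
by move=> [B ->] [B' ->]; exists (B + B'); rewrite map_mxD.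
Qed.

Let S_mul t M P : S t M -> S t P -> S t (M * P).
Proof.
case: t => /=; first exact: Generated_mul.
by move=> [B ->] [B' ->]; exists (B *m B'); rewrite map_mxM.
Qed.

(** The shifts p -> g p and p -> g^-1 p of a group, where g != g^-1. *)
Variable s : bool -> 'I_n -> 'I_n.
Hypothesis sK : forall b, cancel (s b) (s (~~ b)).
Hypothesis s_neq : forall b p, s b p != p.
Hypothesis s_neqN : forall b p, s b p != s (~~ b) p.

Let e (i : bool * 'I_n) : 'M[A]_n := delta_mx i.2 (s i.1 i.2).
Let Z : 'M[A]_n := \sum_i e i * X * e i.

(** Half of the r-th free cumulant of Z: a block of r letters is determined by its
    first shift, of which there are two. *)
Definition even_cumulant r : C :=
  if odd r then 0 else n%:R * n%:R^-1 ^+ r * kappa r.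

Let M := cumulants_to_moments (fun r => 2%:R * even_cumulant r).

Let op_Z := op_sandwich phi X e e.

(** An open block that started with X at the entry (s b p0, p0) carries on its left
    the matrix unit that joins its current end to the required start of the next
    letter. Each mark retraces the last step and so swaps the two indices, which is
    why the matrix unit depends on the parity of r only. The factor N^(r-2) is
    forced: a mark raises r by one and costs the N^-1 of the gap that it closes,
    and ending a block of r letters costs N^-1 = N^(r-2) N^(1-r), where
    N^(1-r) is the normalization of even_cumulant. *)
Lemma iter_op_Z b p0 q K :
    (forall i, (i <= K)%N -> forall p q, tau ((Z ^+ i) p q) = (p == q)%:R * M i) ->
  forall m r k, (m + k <= K)%N ->
    iter m op_Z (op_left (delta_mx q (s b p0)) (close_block phi kappa)) r
      ((if odd r then delta_mx p0 (s b p0) else delta_mx (s b p0) p0) * Z ^+ k)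
    = n%:R ^+ r / n%:R ^+ 2 * (p0 == q)%:R * open_block_sum even_cumulant M m r k.
Proof.
move=> defM; elim=> [|m IHm] r k le_K /=.
  rewrite /op_left /close_block /even_cumulant.
  case: (odd r); rewrite mx_functional_delta_mx2.
    by rewrite eq_sym (negPf (s_neq _ _)); rewrite !(mul0r, mulr0).
  rewrite eqxx mul1r defM //; have nr : n%:R ^+ r != 0 :> C by apply: expf_neq0.
  by rewrite exprVn; field; rewrite nr n_neq0.
have [le_k le_m] : (k <= K)%N /\ (m + 0 <= K)%N by clear -le_K; lia.
set f1 := op_left _ _ in IHm *; rewrite {1}/op_Z /op_sandwich -/Z.
set D := if odd r then _ else _.
have -> : D * Z ^+ k * Z = D * Z ^+ k.+1 by rewrite -mulrA -exprSr.
rewrite IHm; last by rewrite addnS.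
rewrite {}/D.
have step c v : let u := s c v in
  \sum_i phi (delta_mx u v * Z ^+ k * e i) *
    iter m op_Z f1 r.+1 (e i)
  = n%:R^-1 * M k *
    iter m op_Z f1 r.+1
      (delta_mx v u).
  move=> u; rewrite (bigD1 (c, v)) //= big1 ?addr0 => [|[c' v'] neq].
    by rewrite mx_functional_delta_mx2 eqxx mul1r defM // eqxx mul1r.
  rewrite mx_functional_delta_mx2 defM //.
  (* the gap must close up, and the shift must lead from v to u *)
  have [eqv|_] := eqVneq v v'; last by rewrite !(mul0r, mulr0).
  rewrite -eqv in neq *; case: eqP => [equ|_]; last by rewrite !(mul0r, mulr0).
  case: (eqVneq c' c) neq => [->|neqc]; first by rewrite eqxx.
  have := s_neqN c v; rewrite -/u equ; case: (c) (c') neqc => [] [] //;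
    by rewrite eqxx.
have IH0 := IHm r.+1 0%N; rewrite !expr0 mulr1 /= in IH0.
case: (odd r) IH0 => /= IH0.
  have := step (~~ b) (s b p0); rewrite /= sK => ->.
  rewrite IH0 //.
  by rewrite [_ ^+ r.+1]exprS; field; rewrite n_neq0.
rewrite step IH0 //.
by rewrite [_ ^+ r.+1]exprS; field; rewrite n_neq0.
Qed.

Lemma Z_mull (P : 'M[A]_n) p q :
  (Z * P) p q = \sum_b X (s b p) p * P (s b p) q.
Proof.
rewrite /Z mulr_suml summxE -(pair_bigA _ (fun b p' =>
  (delta_mx p' (s b p') * X * delta_mx p' (s b p') * P) p q)) /=.
apply: eq_bigr => b _; rewrite (bigD1 p) //= big1 ?addr0 => [|p' neq].
  by rewrite delta_mx_mid delta_mx_mull eqxx mul1r.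
by rewrite delta_mx_mid delta_mx_mull eq_sym (negPf neq) !mul0r.
Qed.

(** Z^(m+1) is expanded along its first step p -> s b p; multiplying by matrix
    units on the right of X turns each term into a word to which the
    Schwinger-Dyson equation applies. *)
Lemma tau_expr_Z m p q : tau ((Z ^+ m) p q) = (p == q)%:R * M m.
Proof.
elim/ltn_ind: m p q => -[_|m IHm] p q.
  rewrite /M cumulants_to_moments0 expr0 mxE.
  by rewrite -[X in tau X]mulr1 tau_natl tau1.
rewrite exprS Z_mull linear_sum /=.
have term b : tau (X (s b p) p * (Z ^+ m) (s b p) q) =
    (p == q)%:R * open_block_sum even_cumulant M m 1 0.
  have := @schwinger_dyson_sandwich _ _ phi j scalar_alg_central mx_functionalD
    mx_functionalZ mx_functional1 S S_scalar S_add S_mul X_free X kappa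
    (Generated_gen X) moments_X _ e e (delta_mx p (s b p)) (delta_mx q (s b p)) m
    (fun i => scalar_entries_delta_mx _ _) (fun i => scalar_entries_delta_mx _ _)
    (scalar_entries_delta_mx _ _) (scalar_entries_delta_mx _ _).
  rewrite -/Z -/op_Z.
  have := @iter_op_Z b p q m IHm m 1 0; rewrite addn0 mulr1 /= => -> //.
  have -> : phi (X * (delta_mx p (s b p) * (Z ^+ m * delta_mx q (s b p)))) =
      n%:R^-1 * tau (X (s b p) p * (Z ^+ m) (s b p) q).
    by rewrite mulrA [X * _ * _]mulrA mx_functional_delta_mx delta_mx_mid.
  move/(congr1 (fun x => n%:R * x)); rewrite mulVKf // => ->.
  by field; rewrite n_neq0.
under eq_bigr do rewrite term.
rewrite sumr_const card_bool /M cumulants_to_moments_first_block open_block_sumZ.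
by rewrite -/M; ring.
Qed.

Theorem moments_two_shifts m : phi (Z ^+ m) = M m.
Proof.
rewrite /phi /mx_functional (eq_bigr (fun=> M m)) => [|h _].
  by rewrite sumr_const card_ord -[M m *+ n]mulr_natl mulKf.
by rewrite tau_expr_Z eqxx mul1r.
Qed.

End Matrices.

(** * The distribution of Y_g + Y_(g^-1) *)

Local Open Scope complex_scope.

Theorem proposition4p12 (R : realType) (A : algType R[i])
    (star : A -> A) (tau : {scalar A})
    (gT : finGroupType) (e : 'I_#|gT| -> gT)
    (X : 'M[A]_#|gT|) (mu : nat -> R[i]) (Rep : {set gT}) :
  star_operation star ->
  unital_trace tau ->
  bijective e ->
  selfadjoint_mx star X ->
  free_from_scalar_mx tau X ->
  distribution (mx_functional tau) X =1 mu ->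
  inverse_pair_reps Rep ->
  let N : R[i] := #|gT|%:R in
  let Y := left_circulant e X^T in
  forall g : gT, g \in Rep ->
    distribution (mx_functional tau) (Y g + Y g^-1%g) =1
      free_convolution
        (free_power (dilation N^-1 mu) N)
        (free_power (dilation (- N^-1) mu) N).
Proof.
move=> _ [tau1 _] [e' eK e'K] _ freeX distX repR N Y g Rep_g m.
have neq_gV : g != g^-1%g.
  have /andP[_ /andP[/subsetP/(_ g Rep_g) + _]] := repR.
  by rewrite inE.
have neq_g1 : g != 1%g by apply: contraNneq neq_gV => ->; rewrite invg1.
have N_neq0 : N != 0.
  by rewrite Num.Theory.pnatr_eq0 -lt0n; apply/card_gt0P; exists 1%g.
pose h (b : bool) := if b then g else g^-1%g.
have hN b : h (~~ b) = (h b)^-1%g by case: b; rewrite /= ?invgK.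
pose s b p := e' (h b * e p)%g.
have sK b : cancel (s b) (s (~~ b)).
  by move=> p; rewrite /s e'K hN mulKg eK.
have s_neq b p : s b p != p.
  apply: contraNneq neq_g1 => /(congr1 e); rewrite e'K -[RHS]mul1g => /mulIg.
  by case: b => /= [->//|/(congr1 invg)]; rewrite invgK invg1 => ->.
have s_neqN b p : s b p != s (~~ b) p.
  apply: contraNneq neq_gV => /(congr1 e); rewrite !e'K => /mulIg.
  by case: b => /= /eqP //; rewrite eq_sym.
have moments_X k : mx_functional tau (X ^+ k) =
    cumulants_to_moments (free_cumulant mu) k.
  case: k => [|k]; last by rewrite free_cumulantK -distX.
  by rewrite expr0 (mx_functional1 tau1 N_neq0) cumulants_to_moments0.
have defZ : Y g + Y g^-1%g = \sum_(i : bool * 'I_#|gT|)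
    delta_mx i.2 (s i.1 i.2) * X * delta_mx i.2 (s i.1 i.2).
  apply/matrixP => p q; rewrite summxE !mxE.
  rewrite -(pair_bigA _ (fun b p' => (delta_mx p' (s b p') * X *
    delta_mx p' (s b p')) p q)) /= big_bool.
  have entry b : \sum_j (delta_mx j (s b j) * X * delta_mx j (s b j)) p q =
      if e q == (h b * e p)%g then X^T p q else 0.
    rewrite (bigD1 p) //= big1 => [|j neq]; last first.
      by rewrite delta_mx_mul2 eq_sym (negPf neq) mul0r.
    rewrite delta_mx_mul2 eqxx addr0 mxE -(inj_eq (can_inj eK)) e'K.
    case: eqP => [eq_q|_]; last by rewrite mul0r.
    by rewrite mul1r /s -eq_q eK.
  by rewrite !entry !mxE.
rewrite /distribution defZ.
rewrite (moments_two_shifts tau1 N_neq0 freeX moments_X sK s_neq s_neqN).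
apply: eq_cumulants_to_moments => -[//|r] _.
rewrite !cumulants_to_momentsK !free_cumulant_dilation /even_cumulant.
rewrite exprNn -signr_odd; case: (odd r.+1); rewrite -/N; ring.
Qed.
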